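(* Let $q=mf+1$ be a power of a prime $p$, with $m,f$ positive integers, and suppose that $m$ is odd. Then the following statements hold. (a) $H_{q,m}$ is never a nontrivial difference set in $\mathbb{F}_q$. (b) $M_{q,m}$ is a nontrivial difference set in $\mathbb{F}_q$ if and only if $(q,m)=(16,3)$.
   Context: For a prime power $q=mf+1$ with $m,f\in\mathbb{Z}_{>0}$, $H_{q,m}$ denotes the set of nonzero $m$th powers in $\mathbb{F}_q$ (so $|H_{q,m}|=f$), and $M_{q,m}=H_{q,m}\cup\{0\}$. A subset $D$ of size $k$ of a finite group $F$ of order $v$ is a $(v,k,\lambda)$-difference set (or simply a difference set) if for each nonidentity $a\in F$ there are exactly $\lambda$ ordered pairs $(x,y)\in D\times D$ with $xy^{-1}=a$. ''Difference set in $\mathbb{F}_q$'' means difference set in the additive group of $\mathbb{F}_q$ (so $xy^{-1}$ becomes $x-y$). The difference set is called nontrivial if $k-\lambda>1$, and trivial if $k-\lambda\leqslant 1$. *)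

(* Defs.v *)
From HB Require Import structures.
From mathcomp Require Import all_boot all_fingroup all_algebra.

Set Implicit Arguments.
Unset Strict Implicit.
Unset Printing Implicit Defensive.

Import GRing.Theory.

Section DifferenceSets.

Variable gT : finGroupType.
Implicit Types D : {set gT}.

Definition is_difference_set_with (v k lambda : nat) D : Prop :=
  [/\ #|gT| = v, #|D| = k &
      forall a : gT, a != 1%g ->
        #|[set xy in setX D D | xy.1 * xy.2^-1 == a]%g| = lambda].

(* The test 1 < k - lambda uses truncated subtraction, which is harmless: it
   holds exactly when lambda + 1 < k. *)
Definition nontrivial_difference_set D : Prop :=
  exists v k lambda : nat,
    is_difference_set_with v k lambda D /\ 1 < k - lambda.

End DifferenceSets.

Section PowerSets.

Local Open Scope ring_scope.

Variable F : finFieldType.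

Definition nonzero_powers (m : nat) : {set F} :=
  [set x ^+ m | x in [set x : F | x != 0]].

Definition powers_with_zero (m : nat) : {set F} := 0 |: nonzero_powers m.

(* A finFieldType is canonically a finGroupType for its addition, so that the
   group-theoretic notion above is the additive one on subsets of F. *)
Lemma is_difference_set_withE v k lambda (D : {set F}) :
  is_difference_set_with v k lambda D <->
  [/\ #|F| = v, #|D| = k &
      forall a : F, a != 0 ->
        #|[set xy in setX D D | xy.1 - xy.2 == a]| = lambda].
Proof. by []. Qed.

End PowerSets.

(* Main.v *)
Require Import Defs.
From mathcomp Require Import all_boot all_fingroup all_algebra.
From mathcomp Require Import all_solvable all_field all_character zify ring.

(** Write H for the nonzero m-th powers and M = H with 0 added. As the
    multiplicative group of a field with q = m f + 1 elements is cyclic of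
    order m f, H is its subgroup of order f, the set of f-th roots of unity
    ([nonzero_powersE] obtains this by counting roots of polynomials).
    Counting pairs of distinct elements of a difference set D with parameters
    (v, k, lambda) gives k (k - 1) = lambda (v - 1); a nontrivial one therefore
    misses at least two elements of the group. The proof depends on the parity
    of q.

    Let q be odd. As m is odd, - 1 = (- 1) ^ m is in H, so H = - H and M = - M.
    For a symmetric D, the map (x, y) |-> (- y, - x) is an involution on the
    pairs of difference 2 b, whose only possible fixed point is (b, - b); hence
    lambda is congruent modulo 2 to the indicator of D at b, for every nonzero
    b. As D contains a nonzero element, it contains all of them and is trivial
    ([symmetric_difference_set_trivial]).

    Let q = 2 ^ e. All characters of the additive group take the values 1 and
    - 1, so the sum S of a nontrivial character over D is an integer with
    S ^ 2 = n, where n = k - lambda. By Fourier inversion a prime dividing n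
    divides q, so n is a power of 2 ([nontrivial_difference_order_2nat]).
    For D = H, k = f is odd and the counting equation reads f - 1 = lambda m;
    hence lambda is even, n is odd, and n = 1.
    For D = M, k = f + 1 and the counting equation reads f + 1 = lambda m;
    hence n = lambda (m - 1), so that lambda = 2 ^ a and m - 1 = 2 ^ b.
    Eliminating f leaves 2 ^ e + 2 ^ b = 2 ^ a (2 ^ b + 1) ^ 2, whose only
    relevant solution is a = b = 1, e = 4 ([two_power_equation]).

    Conversely, let q = 16 and m = 3. In characteristic 2 the pairs of
    difference a are the pairs of sum a and are stable under swapping, so a
    single representation a = x + y in M yields two pairs. Such a
    representation always exists ([sum_powers_with_zero_16]), and since there
    are 6 * 5 pairs of distinct elements for 15 nonzero differences, each
    difference occurs exactly twice. *)

Set Implicit Arguments.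
Unset Strict Implicit.
Unset Printing Implicit Defensive.

Import GRing.Theory Num.Theory.

(** * Counting differences *)

Lemma sum_difference_counts (gT : finGroupType) (V : nmodType) (D : {set gT})
    (w : gT -> V) :
  (\sum_(x in D) \sum_(y in D) w (x * y^-1)%g =
   \sum_a w a *+ #|[set xy in setX D D | xy.1 * xy.2^-1 == a]%g|)%R.
Proof.
rewrite pair_big_dep /=.
rewrite (partition_big (fun p : gT * gT => p.1 * p.2^-1)%g predT) //=.
apply: eq_bigr => a _.
rewrite -sumr_const; apply: eq_big => [p|p /andP[_ /eqP ->]] //.
by rewrite !inE.
Qed.

Lemma difference_count1 (gT : finGroupType) (D : {set gT}) :
  #|[set xy in setX D D | xy.1 * xy.2^-1 == 1]%g| = #|D|.
Proof.
have <- : #|[set (x, x) | x in D]| = #|D| by apply: card_imset => x y [].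
apply: eq_card => -[x y]; rewrite !inE /=; apply/idP/imsetP.
  case/andP=> /andP[xD yD] /eqP /(congr1 (mulg^~ y)).
  by rewrite mulgKV mul1g => ->; exists y.
by case=> z zD [-> ->]; rewrite zD mulgV eqxx.
Qed.

Lemma sum_difference_counts_nat (gT : finGroupType) (D : {set gT}) :
  \sum_(a : gT | a != 1%g) #|[set xy in setX D D | xy.1 * xy.2^-1 == a]%g|
    = #|D| * #|D|.-1.
Proof.
have := sum_difference_counts D (fun=> 1%N).
rewrite !sum_nat_const muln1 (eq_bigr _ (fun a _ => natn _)).
rewrite (bigD1 1%g) //= difference_count1.
case: (#|D|) => [|n] /=; first by rewrite add0r.
by rewrite mulnS => /addnI.
Qed.

Lemma difference_set_params (gT : finGroupType) v k l (D : {set gT}) :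
  is_difference_set_with v k l D -> k * k.-1 = l * v.-1.
Proof.
case=> cG cD cnt; move: (sum_difference_counts_nat D).
rewrite cD (eq_bigr (fun=> l)) // sum_nat_const => <-.
rewrite mulnC -cG; congr (_ * _).
by rewrite -[RHS](cardC1 (1%g : gT)); apply: eq_card => x; rewrite !inE.
Qed.

(** By the counting equation, k = v > 1 gives lambda = v and k = v - 1 > 0 gives
    lambda = v - 2; in both cases k - lambda <= 1. *)
Lemma nontrivial_proper v k l :
  k * k.-1 = l * v.-1 -> 1 < k - l -> k <= v -> k.+1 < v.
Proof.
move=> e n_gt1 kv; have [//|vk] := ltnP k.+1 v.
have [kE|vE] : k = v \/ v = k.+1 by lia.
  by subst v; nia.
by subst v; nia.
Qed.

Local Open Scope ring_scope.

(** * Difference sets in elementary abelian 2-groups *)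

(** For a nontrivial character the sum over D has square k - l, and it is an
    integer because the group has exponent 2. If a prime r divides k - l, it
    divides these sums, and Fourier inversion shows that the indicator function
    of D multiplied by the order of the group is constant modulo r. *)
Lemma nontrivial_difference_order_2nat
    (gT : finGroupType) v k l (D : {set gT}) :
    (forall x : gT, x * x = 1)%g -> is_difference_set_with v k l D ->
  (1 < k - l)%N -> (2.-nat (k - l))%N.
Proof.
move=> sq1 dsD ntD; have par := difference_set_params dsD.
case: dsD => cG cD cnt.
have kv : (k <= v)%N by rewrite -cD -cG max_card.
have {}kv : (k.+1 < v)%N := nontrivial_proper par ntD kv.
apply/pnatP; first by lia.
move=> r pr_r r_dv; rewrite inE; apply/eqP.
(* By Cauchy's theorem a prime dividing the order of the group is 2. *)
suff rv : (r %| #|[set: gT]|)%N.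
  case: (Cauchy pr_r rv) => x _ ox.
  have : (#[x]%g %| 2)%N by rewrite order_dvdn expgS expg1 sq1.
  by rewrite ox dvdn_prime2 // => /eqP.
have invx (x : gT) : (x^-1 = x)%g by apply/eqP; rewrite eq_invg_mul sq1.
pose G := [set: gT]%G.
have abG : abelian G.
  apply/centsP => x _ y _; rewrite /commute -[LHS]invx invMg !invx //.
have linG (i : Iirr G) : 'chi_i \is a linear_char by apply/char_abelianP.
pose s (i : Iirr G) x : int := if 'chi_i x == 1 then 1 else -1.
have sE i x : 'chi_i x = (s i x)%:~R.
  have := lin_charM (linG i) (in_setT x) (in_setT x).
  rewrite sq1 lin_char1 // /s => /esym/eqP; rewrite -expr2 sqrf_eq1.
  by case/orP=> /eqP ->; rewrite ?eqxx //; case: ifP => [/eqP ->|].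
pose S i : int := \sum_(x in D) s i x.
have SE i : (S i)%:~R = \sum_(x in D) 'chi_i x.
  by rewrite rmorph_sum; apply: eq_bigr => x _; rewrite sE.
have S_sqr i : i != 0 -> S i * S i = (k - l)%N%:Z.
  move=> i0; apply: (@intr_inj algC).
  rewrite rmorphM /= SE mulr_suml.
  (* Collect the terms of S ^ 2 by the value of x * y^-1: the identity occurs k
     times, every other element l times, and the character sums to 0. *)
  transitivity (\sum_(x in D) \sum_(y in D) 'chi_i (x * y^-1)%g).
    apply: eq_bigr => x _; rewrite mulr_sumr.
    by apply: eq_bigr => y _; rewrite invx lin_charM ?inE.
  rewrite sum_difference_counts (bigD1 1%g) //=.
  rewrite (eq_bigr (fun a => 'chi_i a *+ l)); last by move=> a a1; rewrite cnt.
  have chi_sum0 : \sum_a 'chi_i a = 0.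
    have := first_orthogonality_relation i (0 : Iirr G).
    rewrite (negPf i0) => /eqP; rewrite mulf_eq0 invr_eq0 pnatr_eq0.
    rewrite -[_ == 0%N]negbK -lt0n cardG_gt0 /= => /eqP sum0.
    rewrite -[RHS]sum0.
    by apply: eq_big => [x|x _]; rewrite ?inE // irr0 cfun1E inE mulr1.
  rewrite sumrMnl.
  have -> : \sum_(a | a != 1%g) 'chi_i a = - 1.
    move: chi_sum0; rewrite (bigD1 1%g) //= lin_char1 // => /eqP.
    by rewrite addrC addr_eq0 => /eqP.
  have -> : #|[set xy in setX D D | (xy.1 * xy.2^-1)%g == 1%g]| = k.
    by rewrite difference_count1.
  rewrite lin_char1 // mulNrn -mulrnBr; last by lia.
  by [].
have r_S i : i != 0 -> (r %| S i)%Z.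
  move=> /S_sqr e; have : (r %| S i * S i)%Z by rewrite e.
  rewrite !dvdzE /= abszM Euclid_dvdM // orbb //.
have [y yD] : exists y, y \in D by apply/card_gt0P; lia.
have [z zD] : exists z, z \notin D.
  have /card_gt0P[z] : (0 < #|~: D|)%N.
    by rewrite -(ltn_add2l #|D|) cardsC addn0 cG cD; lia.
  by rewrite inE; exists z.
have inversion x : \sum_i S i * s i x = (#|G| * (x \in D))%N%:Z.
  apply: (@intr_inj algC); rewrite rmorph_sum /=.
  transitivity (\sum_(t in D) \sum_i 'chi[G]_i t * ('chi_i x)^*).
    rewrite exchange_big /=; apply: eq_bigr => i _.
    rewrite rmorphM /= SE mulr_suml; apply: eq_bigr => t _.
    by rewrite (sE i x) conj_intr.
  under eq_bigr => t _ do rewrite second_orthogonality_relation ?inE //.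
  have cent t : 'C_G[t]%g = G.
    apply/setP=> u; rewrite !in_setI !in_setT; apply/cent1P.
    by apply: (centsP abG); rewrite inE.
  have class1 t : (t \in x ^: G)%g = (t == x).
    apply/imsetP/eqP => [[u _ ->]|->]; last by exists 1%g; rewrite ?inE ?conjg1.
    by apply/conjg_fixP/commgP; apply: (centsP abG); rewrite inE.
  under eq_bigr => t _ do rewrite cent class1.
  have [xD|xD] := boolP (x \in D).
    rewrite (bigD1 x) //= eqxx big1 ?addr0 ?muln1 // => t /andP[_ /negPf ->].
    by rewrite mulr0n.
  rewrite big1 ?muln0 // => t tD; case: eqP => [e|_]; last by rewrite mulr0n.
  by rewrite -e tD in xD.
(* Subtracting the inversion formulas at a point of D and at a point outside
   cancels the trivial character, the only one whose sum r need not divide. *)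
have : (r %| (#|G|)%:Z)%Z.
  have -> : (#|G|)%:Z = \sum_i S i * (s i y - s i z).
    under eq_bigr => i _ do rewrite mulrBr.
    by rewrite big_split /= sumrN !inversion yD (negPf zD) muln0 muln1 subr0.
  apply: rpred_sum => i _.
  have [->|i0] := eqVneq i 0; last by rewrite dvdz_mulr ?r_S.
  by rewrite /s irr0 !cfun1E !inE eqxx subrr mulr0 dvdz0.
by rewrite dvdzE.
Qed.

(** * Symmetric difference sets in odd characteristic *)

Lemma even_card_involution (T : finType) (s : T -> T) (A : {set T}) :
    involutive s -> {in A, forall x, s x \in A} -> {in A, forall x, s x != x} ->
  ~~ odd #|A|.
Proof.
move=> sK; move: {2}#|A| (leqnn #|A|) => n.
elim: n A => [|n IHn] A leA sA s_neq.
  by move: leA; rewrite leqn0 => /eqP->.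
have [->|[x xA]] := set_0Vmem A; first by rewrite cards0.
have sxA : s x \in A :\ x by rewrite in_setD1 s_neq ?sA.
move: leA; rewrite (cardsD1 x A) xA (cardsD1 (s x) (A :\ x)) sxA => leA.
rewrite oddD oddD addbA addFb; apply: IHn.
  by move: leA; rewrite !add1n; apply: ltnW.
  move=> y; rewrite !inE => /and3P[ysx yx yA].
  by rewrite sA // andbT (inj_eq (inv_inj sK)) yx (inv_eq sK) ysx.
by move=> y; rewrite !inE => /and3P[_ _]; apply: s_neq.
Qed.

(** The involution (x, y) |-> (- y, - x) on the pairs of difference 2 b has
    (b, - b) as its only possible fixed point, so l has the parity of the
    indicator of D at b. This parity does not depend on b, so D contains either
    every nonzero element or none. *)
Lemma symmetric_difference_set_trivial (F : finFieldType) (D : {set F}) :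
    2%:R != 0 :> F -> {in D, forall x, - x \in D} ->
    (exists2 x, x \in D & x != 0) ->
  ~ nontrivial_difference_set D.
Proof.
move=> nz2 symD [x0 x0D nz_x0] [v [k [l [dsD ntD]]]].
have par := difference_set_params dsD.
case/is_difference_set_withE: dsD => cF cD cnt.
have parity (b : F) : b != 0 -> (b \in D) = odd l.
  move=> nz_b; have nz_2b : b + b != 0 by rewrite -mulr2n -mulr_natl mulf_neq0.
  rewrite -(cnt _ nz_2b); set P := [set xy in _ | _].
  pose s (xy : F * F) := (- xy.2, - xy.1).
  have sK : involutive s by case=> x y; rewrite /s /= !opprK.
  have sP xy : xy \in P -> s xy \in P.
    case: xy => x y; rewrite !inE /= opprK [- y + x]addrC.
    case/andP=> /andP[xD yD] ->.
    by rewrite !symD.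
  have s_fix xy : xy \in P -> s xy = xy -> xy = (b, - b).
    case: xy => x y; rewrite !inE /= => /andP[_ /eqP e] [ey ex].
    have e2 : 2%:R * x = 2%:R * b :> F.
      by rewrite !mulr_natl !mulr2n -e -ex opprK.
    by rewrite -ex (mulfI nz2 e2).
  rewrite (cardsD1 (b, - b) P) oddD.
  rewrite (negPf (even_card_involution sK _ _)).
  - rewrite !inE /= opprK eqxx andbT addbF.
    have -> : (- b \in D) = (b \in D).
      by apply/idP/idP=> /symD; rewrite ?opprK.
    by rewrite andbb; case: (b \in D).
  - move=> xy; rewrite !in_setD1 => /andP[nxy xyP]; rewrite sP // andbT.
    apply: contra nxy => /eqP/(congr1 s); rewrite sK => ->.
    by rewrite /s /= opprK.
  move=> xy; rewrite in_setD1 => /andP[nxy /s_fix fx].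
  by apply: contra nxy => /eqP/fx/eqP.
have l_odd : odd l by rewrite -(parity x0).
have kv : (k <= v)%N by rewrite -cD -cF max_card.
suff : (v <= k.+1)%N by rewrite leqNgt (nontrivial_proper par).
have : (#|[set~ 0%R : F]| <= k)%N.
  rewrite -cD; apply/subset_leq_card/subsetP=> x; rewrite !inE => x_nz.
  by rewrite parity.
by rewrite cardsC1 cF; lia.
Qed.

(** * Power sets as roots of unity *)

Lemma card_root_of_power (F : finFieldType) n (c : F) :
  (0 < n)%N -> (#|[set x : F | x ^+ n == c]| <= n)%N.
Proof.
move=> n_gt0; have sP := size_XnsubC c n_gt0.
rewrite -ltnS -[n.+1]sP cardE; apply: max_poly_roots; last exact: enum_uniq.
  by rewrite -size_poly_gt0 sP.
by apply/allP=> x; rewrite mem_enum inE rootE !hornerE subr_eq0.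
Qed.

(** An m-th power is an f-th root of unity, and there are at most f of those;
    the m f nonzero elements are distributed over the fibres of x |-> x ^ m,
    which have at most m elements each, so there are at least f m-th powers. *)
Lemma nonzero_powersE (F : finFieldType) m f :
    #|F| = (m * f + 1)%N -> (0 < f)%N ->
  nonzero_powers F m = [set y | y ^+ f == 1] /\ #|nonzero_powers F m| = f.
Proof.
move=> cF f_gt0; set H := nonzero_powers F m.
have m_gt0 : (0 < m)%N.
  by have := finNzRing_gt1 F; rewrite cF; case: (m).
have sHf : H \subset [set y | y ^+ f == 1].
  apply/subsetP=> y /imsetP[x]; rewrite !inE => x0 ->.
  rewrite -exprM -(inj_eq (mulfI x0)) mulr1 -exprS -[(_ * _).+1]addn1 -cF.
  by rewrite expf_card.
have leHf : (#|H| <= f)%N.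
  exact: leq_trans (subset_leq_card sHf) (card_root_of_power _ f_gt0).
have lefH : (f <= #|H|)%N.
  rewrite -(leq_pmul2l m_gt0).
  have -> : (m * f)%N = #|[set x : F | x != 0]|.
    have := cardsC1 (0 : F); rewrite cF addn1 /= => <-.
    by apply: eq_card => x; rewrite !inE.
  rewrite -sum1_card (partition_big_imset (fun x : F => x ^+ m)) /=.
  rewrite mulnC -sum_nat_const; apply: leq_sum => y _.
  rewrite sum1dep_card; apply: leq_trans (card_root_of_power y m_gt0).
  by apply/subset_leq_card/subsetP=> x; rewrite !inE => /andP[].
have cH : #|H| = f by apply/eqP; rewrite eqn_leq leHf.
split=> //; apply/eqP; rewrite eqEcard sHf cH.
exact: card_root_of_power.
Qed.

(** * Characteristic two *)

(** With l = 2 ^ a and m = 2 ^ b + 1, eliminating f gives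
    2 ^ e + 2 ^ b = 2 ^ a * (2 ^ b + 1) ^ 2, where a and b are less than e.
    Comparing 2-adic valuations gives a = b. Then
    2 ^ (e - b) = 2 ^ b.+1 * (2 ^ b.-1 + 1), and for b > 1 the last factor is
    odd and greater than 1, so it cannot divide a power of 2; hence b = 1. *)
Lemma two_power_equation e m f l : odd m -> (2 ^ e = m * f + 1)%N ->
  (f + 1 = l * m)%N -> (2.-nat (l * (m - 1)))%N -> (1 < l * (m - 1))%N ->
  (2 ^ e = 16 /\ m = 3)%N.
Proof.
rewrite pnatM => m_odd q_eq f_eq /andP[/p_natP[a l_eq] /p_natP[b m_eq]] n_gt1.
have b_gt0 : (0 < b)%N.
  by case: b m_eq => [|b //]; case: m m_odd {q_eq f_eq n_gt1}; lia.
have m_eq2 : m = (2 ^ b + 1)%N by have := odd_gt0 m_odd; lia.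
have eq1 : (2 ^ e + 2 ^ b = 2 ^ a * (2 ^ b + 1) ^ 2)%N.
  have : (m * f + m = 2 ^ a * (m * m))%N.
    by rewrite mulnA -l_eq -f_eq mulnDl mul1n mulnC.
  by rewrite -m_eq2 -mulnn; lia.
have l_gt0 : (0 < l)%N by rewrite l_eq expn_gt0.
have bX_ge2 : (2 <= 2 ^ b)%N by rewrite -{1}(expn1 2) leq_exp2l.
have l_le_f : (l <= f)%N.
  have : (l * 3 <= l * m)%N by rewrite leq_mul2l m_eq2; lia.
  by lia.
have f_le_mf : (f <= m * f)%N by rewrite leq_pmull // odd_gt0.
have m_le_mf : (m <= m * f)%N by rewrite leq_pmulr //; lia.
have b_lt_e : (b < e)%N by rewrite -(ltn_exp2l _ _ (ltnSn 1)) q_eq; lia.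
have a_lt_e : (a < e)%N by rewrite -(ltn_exp2l _ _ (ltnSn 1)) q_eq -l_eq; lia.
have [a_lt_b|b_lt_a|ab] := ltngtP a b.
- have bE : b = (a + (b - a.+1).+1)%N by lia.
  have eE : e = (a + (e - a.+1).+1)%N by lia.
  move: eq1; rewrite {1}eE {1}bE !expnD -mulnDr => /eqP.
  rewrite eqn_pmul2l ?expn_gt0 // => /eqP/(congr1 odd).
  by rewrite oddD !oddX /= oddD oddX (gtn_eqF b_gt0).
- have aE : a = (b + (a - b.+1).+1)%N by lia.
  have eE : e = (b + (e - b.+1).+1)%N by lia.
  move: eq1; rewrite {1}eE {1}aE !expnD -[X in (_ + X)%N]muln1 -mulnDr -mulnA.
  move/eqP; rewrite eqn_pmul2l ?expn_gt0 // => /eqP/(congr1 odd).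
  by rewrite oddD oddM !oddX.
have eE : e = (b + (e - b))%N by lia.
have bE : b = b.-1.+1 by lia.
have eq2 : (2 ^ (e - b) = 2 ^ b.+1 * (2 ^ b.-1 + 1))%N.
  move: eq1; rewrite ab {1}eE expnD -[X in (_ + X)%N]muln1 -mulnDr => /eqP.
  rewrite eqn_pmul2l ?expn_gt0 // => /eqP eq1.
  have e2 : (2 ^ b = 2 * 2 ^ b.-1)%N by rewrite {1}bE expnS.
  by move: eq1; rewrite [(2 ^ b.+1)%N]expnS e2 -mulnn; lia.
have b1 : b.-1 = 0%N.
  have [//|b1_gt0] := posnP b.-1.
  have cop : coprime (2 ^ b.-1 + 1) (2 ^ (e - b)).
    apply: coprimeXr; rewrite coprimen2 oddD oddX; by case: (b.-1) b1_gt0.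
  by move: cop; rewrite eq2 /coprime gcdnMl addn1 eqSS expn_eq0.
have b_eq1 : b = 1%N by rewrite bE b1.
by rewrite m_eq2 eE expnD eq2 b_eq1.
Qed.

Lemma mulgg_char2 (F : finFieldType) e :
  #|F| = (2 ^ e)%N -> forall x : F, (x * x = 1)%g.
Proof. by move=> F2 x; apply: addrr_pchar2; apply: card_finPcharP F2 _. Qed.

Lemma nonzero_powers_char2 (F : finFieldType) e m f :
    #|F| = (2 ^ e)%N -> #|F| = (m * f + 1)%N -> (0 < f)%N -> odd m ->
  ~ nontrivial_difference_set (nonzero_powers F m).
Proof.
move=> F2 cF f_gt0 m_odd [v [k [l [ds n_gt1]]]].
have n2 := nontrivial_difference_order_2nat (mulgg_char2 F2) ds n_gt1.
have m_gt0 := odd_gt0 m_odd.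
have even_F : ~~ odd #|F|.
  by have := finNzRing_gt1 F; rewrite F2 oddX; case: (e).
have par := difference_set_params ds; case: ds => Fv kE _.
have [_ cH] := nonzero_powersE cF f_gt0.
move: even_F; rewrite cF oddD oddM m_odd /= addbT negbK => f_odd.
move: Fv par; rewrite cF => <-; rewrite -kE cH in n2 n_gt1 *.
rewrite addn1 /= mulnA [(l * m * f)%N]mulnC => /eqP.
rewrite eqn_pmul2l // => /eqP fE.
(* In f.-1 = l * m the left-hand side is even and m is odd. *)
have l_even : ~~ odd l.
  by have := congr1 odd fE; rewrite oddM m_odd andbT -subn1 oddB // f_odd => <-.
have n_odd : odd (f - l) by rewrite oddB ?f_odd //; lia.
by case/p_natP: n2 => [[|j] nE]; rewrite nE ?oddX // in n_odd n_gt1.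
Qed.

Lemma powers_with_zero_char2 (F : finFieldType) e m f :
    #|F| = (2 ^ e)%N -> #|F| = (m * f + 1)%N -> (0 < f)%N -> odd m ->
  nontrivial_difference_set (powers_with_zero F m) -> #|F| = 16%N /\ m = 3%N.
Proof.
move=> F2 cF f_gt0 m_odd [v [k [l [ds n_gt1]]]].
have n2 := nontrivial_difference_order_2nat (mulgg_char2 F2) ds n_gt1.
have m_gt0 := odd_gt0 m_odd.
have par := difference_set_params ds; case: ds => Fv kE _.
have [HE cH] := nonzero_powersE cF f_gt0.
have cM : #|powers_with_zero F m| = f.+1.
  by rewrite cardsU1 cH HE inE expr0n gtn_eqF // eq_sym oner_eq0.
move: Fv par; rewrite cF => <-; rewrite -kE cM in n2 n_gt1 *.
rewrite addn1 /= mulnA => /eqP.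
rewrite eqn_pmul2r // => /eqP fE.
have nE : (f.+1 - l = l * (m - 1))%N by rewrite fE mulnBr muln1.
rewrite nE in n2 n_gt1.
have q_eq : (2 ^ e = m * f + 1)%N by rewrite -F2.
rewrite -addn1 -q_eq.
exact: two_power_equation m_odd q_eq (etrans (addn1 f) fE) n2 n_gt1.
Qed.

(** * The field with 16 elements *)

Lemma two_eq0_16 (F : finFieldType) : #|F| = 16%N -> 2%:R = 0 :> F.
Proof.
move=> cF; have /pcharf0 : 2%N \in [pchar F] by apply: (@card_finPcharP F 2 4).
by [].
Qed.

(** If a is not itself in H, then t = a ^+ 5 is a primitive cube root of unity.
    For u in H other than 1, in characteristic 2,
    (1 + u) ^+ 5 = u + u ^+ 4 is again one, and replacing u by u ^+ 2 turns it
    into the other one. Choosing u with (1 + u) ^+ 5 = t makes x = a / (1 + u)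
    a fifth root of unity, and a = x + x * u. *)
Lemma sum_powers_with_zero_16 (F : finFieldType) (a : F) :
    #|F| = 16%N -> a != 0 ->
  exists x y, [/\ x \in powers_with_zero F 3, y \in powers_with_zero F 3
                & x + y = a].
Proof.
move=> cF nz_a; have ch2 := two_eq0_16 cF.
have [HE cH] : nonzero_powers F 3 = [set y | y ^+ 5 == 1]
               /\ #|nonzero_powers F 3| = 5%N.
  exact: nonzero_powersE.
have [a5|a5] := eqVneq (a ^+ 5) 1.
  by exists a, 0; rewrite addr0 !inE HE !inE a5 !eqxx orbT.
(* The fifth power of a has order dividing 3 and is not 1. *)
have t_eq : (a ^+ 5) ^+ 2 + a ^+ 5 + 1 = 0.
  have e : (a ^+ 5 - 1) * ((a ^+ 5) ^+ 2 + a ^+ 5 + 1) = 0.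
    have e15 : a * a ^+ 15 = a by rewrite -exprS -cF expf_card.
    transitivity (a ^+ 15 - 1); first by ring.
    by apply/eqP; rewrite subr_eq0; apply/eqP/(mulfI nz_a); rewrite e15 mulr1.
  by move/eqP: e; rewrite mulf_eq0 subr_eq0 (negPf a5) => /eqP.
have [u [u1 u5 ut]] :
    exists u : F, [/\ u != 1, u ^+ 5 = 1 & u + u ^+ 4 = a ^+ 5].
  have [u uH u1] : exists2 u, u \in nonzero_powers F 3 & u != 1.
    have : (0 < #|nonzero_powers F 3 :\ 1%R|)%N.
      move: cH; rewrite (cardsD1 1).
      by case: (_ \in _); rewrite ?add1n ?add0n => -[->].
    by case/card_gt0P=> u; rewrite !inE => /andP[u1 uH]; exists u.
  move: uH; rewrite HE inE => /eqP u5.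
  have cyc : u ^+ 4 + u ^+ 3 + u ^+ 2 + u + 1 = 0.
    have e : (u - 1) * (u ^+ 4 + u ^+ 3 + u ^+ 2 + u + 1) = 0.
      by transitivity (u ^+ 5 - 1); [ring | rewrite u5 subrr].
    by move/eqP: e; rewrite mulf_eq0 subr_eq0 (negPf u1) => /eqP.
  (* The values of (1 + u) ^+ 5 at u and at u ^+ 2 are the two roots of
     T ^+ 2 + T + 1 in characteristic 2. *)
  pose w := u + u ^+ 4.
  have : (a ^+ 5 - w) * (a ^+ 5 - (u ^+ 2 + u ^+ 3)) = 0.
    transitivity (((a ^+ 5) ^+ 2 + a ^+ 5 + 1)
        + (1 - a ^+ 5) * (u ^+ 4 + u ^+ 3 + u ^+ 2 + u + 1)
        + (u ^+ 5 - 1) * (u + u ^+ 2) - 2).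
      by rewrite /w; ring.
    by rewrite t_eq cyc u5 ch2 subrr mulr0 mul0r !addr0 subr0.
  move/eqP; rewrite mulf_eq0 !subr_eq0 => /orP[]/eqP ->; first by exists u.
  exists (u ^+ 2); split.
  - apply: contra u1 => /eqP u2; rewrite -u5.
    by rewrite -[5%N]/(2 * 2 + 1)%N exprD exprM u2 !expr1n mul1r.
  - by rewrite -exprM mulnC exprM u5 expr1n.
  by rewrite -exprM -[(2 * 4)%N]/(5 + 3)%N exprD u5 mul1r.
have nz1u : 1 + u != 0.
  apply: contra u1 => /eqP e; rewrite -subr_eq0; apply/eqP.
  by transitivity (1 + u - 2); [ring | rewrite e ch2 subr0].
have u1_5 : (1 + u) ^+ 5 = a ^+ 5.
  rewrite -ut; transitivity (u + u ^+ 4 + (u ^+ 5 - 1)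
      + 2 * (1 + 2 * u + 5 * u ^+ 2 + 5 * u ^+ 3 + 2 * u ^+ 4)).
    by ring.
  by rewrite u5 ch2 subrr mul0r !addr0.
have xH : (a / (1 + u)) ^+ 5 = 1.
  by rewrite expr_div_n u1_5 divff // expf_neq0.
exists (a / (1 + u)), (a / (1 + u) * u); rewrite !inE HE !inE.
rewrite [(_ * u) ^+ 5]exprMn xH u5 mul1r eqxx !orbT.
by split=> //; field.
Qed.

Lemma powers_with_zero_16 (F : finFieldType) :
    #|F| = 16%N ->
  is_difference_set_with 16 6 2 (powers_with_zero F 3).
Proof.
move=> cF; have ch2 := two_eq0_16 cF.
have [HE cH] : nonzero_powers F 3 = [set y | y ^+ 5 == 1]
               /\ #|nonzero_powers F 3| = 5%N.
  exact: nonzero_powersE.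
have cM : #|powers_with_zero F 3| = 6%N.
  by rewrite cardsU1 cH HE inE expr0n eq_sym oner_eq0.
set M := powers_with_zero F 3 in cM *.
have ge2 (a : F) : a != 0 ->
    (2 <= #|[set xy in setX M M | (xy.1 - xy.2)%R == a]|)%N.
  move=> nz_a; have [x [y [xM yM xy]]] := sum_powers_with_zero_16 cF nz_a.
  have xNy : x != y.
    by apply: contra nz_a => /eqP e; rewrite -xy e -mulr2n -mulr_natl ch2 mul0r.
  have opp (z : F) : - z = z.
    by apply/eqP; rewrite eq_sym -addr_eq0 -mulr2n -mulr_natl ch2 mul0r.
  have <- : #|[set (x, y); (y, x)]| = 2%N.
    by rewrite cards2 xpair_eqE negb_and xNy.
  apply/subset_leq_card/subsetP=> z; rewrite in_set2 -/M in xM yM *.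
  by case/orP=> /eqP ->; rewrite inE in_setX xM yM /= opp ?[y + x]addrC xy.
apply/is_difference_set_withE; split=> // a nz_a.
(* The counts add up to 6 * 5 = 15 * 2, so none of them exceeds 2. *)
have := @leqif_sum F (fun a => a != 0) _ (fun=> 2%N) _
          (fun a nz => leqif_eq (ge2 a nz)).
have -> := sum_difference_counts_nat M.
rewrite sum_nat_const cM.
have -> : #|(fun a : F => a != 0)| = 15%N.
  by have := cardC1 (0 : F); rewrite cF => /= <-; apply: eq_card.
case=> _; rewrite eqxx => /esym/forall_inP/(_ a nz_a)/eqP -> //.
Qed.

Local Close Scope ring_scope.

Theorem theorem4p1 (p e q m f : nat) (F : finFieldType)
    (p_prime : prime p) (q_pow : q = p ^ e) (q_eq : q = m * f + 1)
    (m_gt0 : 0 < m) (f_gt0 : 0 < f) (m_odd : odd m) (card_F : #|F| = q) :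
  ~ nontrivial_difference_set (nonzero_powers F m)
  /\ (nontrivial_difference_set (powers_with_zero F m) <-> (q, m) = (16, 3)).
Proof.
have pF : p \in [pchar F]%R by apply: (@card_finPcharP F p e); rewrite ?card_F.
have cF : #|F| = m * f + 1 by rewrite card_F.
have [p2|p_odd] := even_prime p_prime.
  have F2 : #|F| = 2 ^ e by rewrite card_F q_pow p2.
  split; first exact: nonzero_powers_char2 F2 cF f_gt0 m_odd.
  split=> [nt|[q16 m3]].
    have [c16 ->] := powers_with_zero_char2 F2 cF f_gt0 m_odd nt.
    by rewrite -card_F c16.
  rewrite m3; exists 16, 6, 2; split=> //.
  by apply: powers_with_zero_16; rewrite card_F.
have nz2 : (2%:R != 0 :> F)%R.
  by rewrite -(dvdn_pcharf pF) dvdn_prime2 //; apply: contraTneq p_odd => ->.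
have symH : {in nonzero_powers F m, forall x, (- x)%R \in nonzero_powers F m}.
  move=> _ /imsetP[x x0 ->]; apply/imsetP; exists (- x)%R.
    by move: x0; rewrite !inE oppr_eq0.
  by rewrite [RHS]exprNn -signr_odd m_odd expr1 mulN1r.
have H1 : 1%R \in nonzero_powers F m.
  by apply/imsetP; exists 1%R; rewrite ?inE ?oner_eq0 ?expr1n.
split.
  apply: symmetric_difference_set_trivial => //.
  by exists 1%R; rewrite ?oner_eq0.
split=> [|[q16 _]].
  move=> nt; exfalso; move: nt; apply: symmetric_difference_set_trivial => //.
    move=> x; rewrite !in_setU1 oppr_eq0 => /orP[-> //|/symH ->]; exact: orbT.
  by exists 1%R; rewrite ?oner_eq0 // in_setU1 H1 orbT.
by have := congr1 odd q16; rewrite q_pow oddX p_odd orbT.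
Qed.
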